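(* Let $\mathcal{F}$ be a generating family on a group $G$. Then two subsets $A$ and $B$ of $G$ are asymptotically disjoint in the asymptotic resemblance space $(G,\lambda_{\mathcal{F}})$ if and only if $A\cap BH$ is bounded for each $H\in\mathcal{F}$.
   Context: For subsets $A,B$ of a group $G$ put $AB=\{gh\mid g\in A,h\in B\}$ and $A^{-1}=\{g^{-1}\mid g\in A\}$. A generating family $\mathcal{F}$ on $G$ is a family of subsets of $G$ that contains a nonempty subset of $G$ and such that $A\cup B$, $AB$, $A^{-1}\in\mathcal{F}$ for all $A,B\in\mathcal{F}$. Standing assumption: every generating family satisfies $G=\bigcup_{F\in\mathcal{F}}F$. For $A,B\subseteq G$ write $A\lambda_{\mathcal{F}}B$ if there exists $H\in\mathcal{F}$ with $A\subseteq BH$ and $B\subseteq AH$. A subset $A\subseteq G$ is bounded if $A=\emptyset$ or $A\lambda_{\mathcal{F}}\{x\}$ for some $x\in G$. Two subsets $A,B$ of $G$ are asymptotically disjoint if whenever $L_1\subseteq A$, $L_2\subseteq B$ and $L_1\lambda_{\mathcal{F}}L_2$, then $L_1$ and $L_2$ are bounded. *)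

(* Defs.v *)
From mathcomp Require Import all_boot all_classical.

Set Implicit Arguments.
Unset Strict Implicit.
Unset Printing Implicit Defensive.

Local Open Scope classical_set_scope.
Local Open Scope group_scope.

(* A groupType may be infinite; its choiceType structure is no restriction
   classically. *)

Definition set_mul (G : groupType) (A B : set G) : set G :=
  [set g * h | g in A & h in B].

Definition set_inv (G : groupType) (A : set G) : set G :=
  [set g^-1 | g in A].

Record generating_family (G : groupType) (F : set (set G)) : Prop := {
  gen_nonempty : exists2 A, F A & A !=set0;
  gen_setU : forall A B, F A -> F B -> F (A `|` B);
  gen_mul : forall A B, F A -> F B -> F (set_mul A B);
  gen_inv : forall A, F A -> F (set_inv A)
}.

Definition group_resemblance (G : groupType) (F : set (set G))
    (A B : set G) : Prop :=
  exists2 H, F H & A `<=` set_mul B H /\ B `<=` set_mul A H.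

(* lam plays the role of the asymptotic resemblance relation, here
   group_resemblance F. *)
Definition bounded_subset (X : Type) (lam : set X -> set X -> Prop)
    (A : set X) : Prop :=
  A = set0 \/ exists x : X, lam A [set x].

Definition asymptotically_disjoint (X : Type) (lam : set X -> set X -> Prop)
    (A B : set X) : Prop :=
  forall L1 L2 : set X, L1 `<=` A -> L2 `<=` B -> lam L1 L2 ->
    bounded_subset lam L1 /\ bounded_subset lam L2.

(* Main.v *)
(* A set is bounded iff it is contained in a translate [xH] with [H] in [F].
   For the direct implication, [A `&` BH] and [B `&` AH^-1] are asymptotically
   alike.  Conversely, if [L1] and [L2] are alike through [H], then [L1] lies in
   [A `&` BH], hence in some [xK], and then [L2] lies in [xKH]. *)
Require Import Defs.
From mathcomp Require Import all_boot all_classical.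

Local Open Scope classical_set_scope.

Lemma bounded_subsetP (G : groupType) (F : set (set G)) (A : set G) :
  generating_family F ->
  bounded_subset (group_resemblance F) A <->
  exists x : G, exists2 H, F H & A `<=` set_mul [set x] H.
Proof.
move=> genF; split=> [[->|[x [H FH [AxH _]]]]|[x [H FH AxH]]].
- by have [H FH _] := gen_nonempty genF; exists 1%g, H => // ? [].
- by exists x, H.
(* The empty set resembles no point, so it is treated apart. *)
have [->|/set0P[a Aa]] := eqVneq A set0; first by left.
(* [H] leads from [x] to all of [A]; a single point [a = xh] of [A] leads back, as [x = ah^-1]. *)
right; exists x, (H `|` set_inv H).
  by apply: gen_setU => //; exact: gen_inv.
split=> [b /AxH[_ -> [h Hh <-]]|_ ->].
  by exists x => //; exists h => //; left.
have [_ -> [h Hh xha]] := AxH a Aa.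
exists a => //; exists h^-1%g; first by right; exists h.
by rewrite -xha mulgK.
Qed.

Theorem proposition3p3 (G : groupType) (F : set (set G))
    (genF : generating_family F)
    (covF : \bigcup_(H in F) H = [set: G])
    (A B : set G) :
  asymptotically_disjoint (group_resemblance F) A B <->
  (forall H : set G, F H ->
     bounded_subset (group_resemblance F) (A `&` set_mul B H)).
Proof.
split=> [disjAB H FH|bndAB L1 L2 L1A L2B [H FH [L1H L2H]]].
  suff: group_resemblance F (A `&` set_mul B H) (B `&` set_mul A (set_inv H)).
    by case/disjAB=> // ? [].
  (* When [a = bh], also [b = ah^-1]: the two points witness each other's membership, [H] leading
     from [b] to [a] and [set_inv H] back. *)
  exists (H `|` set_inv H).
    by apply: gen_setU => //; exact: gen_inv.
  split=> [a [Aa [b Bb [h Hh bha]]]|b [Bb [a Aa [_ [h Hh <-] ahb]]]].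
    exists b; last by exists h => //; left.
    split=> //; exists a => //.
    by exists h^-1%g; [exists h|rewrite -bha mulgK].
  exists a; last by exists h^-1%g => //; right; exists h.
  by split=> //; exists b => //; exists h => //; rewrite -ahb mulgVK.
have /(bounded_subsetP _ _ _ genF)[x [K FK ABK]] := bndAB H FH.
have L1K : L1 `<=` set_mul [set x] K.
  move=> a L1a; apply: ABK; split; first exact: L1A.
  by have [b /L2B Bb bHa] := L1H a L1a; exists b.
(* The same centre [x] serves both sets. *)
split; apply/(bounded_subsetP _ _ _ genF); exists x; first by exists K.
exists (set_mul K H); first exact: gen_mul.
move=> b /L2H[a /L1K[_ -> [k Kk <-]] [h Hh <-]].
by exists x => //; exists (k * h)%g; [exists k => //; exists h|rewrite mulgA].
Qed.
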